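(* Let $\mathcal{H}$ be a complex Hilbert space and let $A\in\mathcal{B}(\mathcal{H})$. Then for all $\alpha\in[0,1]$, $$w^2(A)\le\left\|\int_0^1\left((1-t)\left(\alpha\left(\frac{|A|+|A^*|}{2}\right)^2+(1-\alpha)|A|^2\right)+t\,w^2(A)I\right)^2dt\right\|^{1/2}\le\left\|\alpha\left(\frac{|A|+|A^*|}{2}\right)^2+(1-\alpha)|A|^2\right\|.$$
   Context: $\mathcal{B}(\mathcal{H})$ is the set of bounded linear operators on $\mathcal{H}$, $A^*$ is the adjoint of $A$, $|A|=(A^*A)^{1/2}$, $I$ is the identity operator, and $\|\cdot\|$ is the operator norm. The numerical radius is $w(A)=\sup\{|\langle Ax,x\rangle| : x\in\mathcal{H},\ \|x\|=1\}$, and $w^2(A)=(w(A))^2$. The integral is the integral over $[0,1]$ of a norm-continuous operator-valued function. *)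

(* Defs.v *)
From HB Require Import structures.
From mathcomp Require Import all_boot all_order all_algebra.
From mathcomp Require Import complex.
From mathcomp Require Import all_classical all_reals all_analysis.

Set Implicit Arguments.
Unset Strict Implicit.
Unset Printing Implicit Defensive.

Import Order.TTheory GRing.Theory Num.Theory.
Import numFieldNormedType.Exports.

Local Open Scope classical_set_scope.
Local Open Scope ring_scope.
Local Open Scope complex_scope.

(* The inner product is linear in its first argument. *)
HB.mixin Record isHilbert (R : realType) H & CompleteNormedModule R[i] H := {
  hdot : {dot H for (@Num.conj R[i] : R[i] -> R[i])} ;
  hdot_norm : forall x : H, hdot x x = `|x| ^+ 2
}.

#[short(type="hilbertType")]
HB.structure Definition Hilbert (R : realType) :=
  {H of CompleteNormedModule R[i] H & isHilbert R H}.

Section RealNorm.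
Variables (R : realType) (V : normedModType R[i]).

(* The norm of a normed module over R[i] takes its values in R[i]; rnorm is
   the same norm, seen in R. *)
Definition rnorm (x : V) : R := complex.Re `|x|.

Lemma rnormE x : (rnorm x)%:C = `|x|.
Proof. by rewrite RRe_real // normr_real. Qed.

Lemma rnorm0 : rnorm 0 = 0.
Proof. by rewrite /rnorm normr0. Qed.

Lemma rnorm_ge0 x : 0 <= rnorm x.
Proof. by rewrite -lecR rnormE; exact: normr_ge0. Qed.

Lemma rnormZ (a : R[i]) (r : R) x : `|a| = r%:C -> rnorm (a *: x) = r * rnorm x.
Proof. by move=> ar; apply: complexI; rewrite rmorphM /= !rnormE normrZ ar. Qed.

Lemma normC_real (a : R[i]) : exists2 r : R, 0 <= r & `|a| = r%:C.
Proof.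
have E : (complex.Re `|a|)%:C = `|a| by rewrite RRe_real // normr_real.
exists (complex.Re `|a|) => //; rewrite -lecR E; exact: normr_ge0.
Qed.

End RealNorm.

Section BoundedOperators.
Variables (R : realType) (V : normedModType R[i]).

Definition bounded_linear (f : V -> V) : Prop :=
  linear f /\ exists M : R, forall x, rnorm (f x) <= M * rnorm x.

Definition bounded_linear_pred : {pred V -> V} :=
  [pred f | `[< bounded_linear f >]].

Lemma bounded_linear_submod : submod_closed bounded_linear_pred.
Proof.
split=> [|a f g].
  apply/asboolP; split=> [a x y|]; first by rewrite /= scaler0 addr0.
  by exists 0 => x; rewrite mul0r rnorm0.
move=> /asboolP[lf [M Mf]] /asboolP[lg [N Ng]]; apply/asboolP.
have E x : (a *: f + g) x = a *: f x + g x by [].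
split=> [b x y|].
  by rewrite !E lf lg !scalerDr !scalerA (mulrC a b) addrACA.
have [r r0 ar] := normC_real a; exists (r * M + N) => x.
rewrite E -lecR mulrDl rmorphD /= rnormE (le_trans (ler_normD _ _))// lerD//.
  by rewrite normrZ ar -rnormE -rmorphM lecR -mulrA ler_wpM2l.
by rewrite -rnormE lecR.
Qed.

HB.instance Definition _ :=
  GRing.isSubmodClosed.Build _ _ bounded_linear_pred bounded_linear_submod.

Record bop := Bop { bop_fun :> V -> V ; bopP : bop_fun \in bounded_linear_pred }.

HB.instance Definition _ := [isSub for bop_fun].
HB.instance Definition _ := [Choice of bop by <:].
HB.instance Definition _ := [SubChoice_isSubLmodule of bop by <:].

Lemma bop_eq (A B : bop) : (forall x, A x = B x) -> A = B.
Proof. by move=> AB; apply/val_inj/funext. Qed.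

Lemma bopD (A B : bop) x : (A + B) x = A x + B x. Proof. by []. Qed.

Lemma bopZ a (A : bop) x : (a *: A) x = a *: A x. Proof. by []. Qed.

Lemma bop_linear (A : bop) : linear A.
Proof. by have /asboolP[] := bopP A. Qed.

HB.instance Definition _ (A : bop) :=
  GRing.isLinear.Build R[i] V V _ A (@bop_linear A).

Lemma id_bounded_linear : idfun \in bounded_linear_pred.
Proof. by apply/asboolP; split=> //; exists 1 => x; rewrite mul1r. Qed.

Lemma comp_bounded_linear (A B : bop) : A \o B \in bounded_linear_pred.
Proof.
apply/asboolP; split=> [a x y /=|]; first by rewrite !linearP.
have /asboolP[_ [M AM]] := bopP A; have /asboolP[_ [N BN]] := bopP B.
exists (`|M| * N) => x /=; rewrite (le_trans (AM _))// -mulrA.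
rewrite (@le_trans _ _ (`|M| * rnorm (B x)))//.
  by rewrite ler_wpM2r ?ler_norm ?rnorm_ge0.
by rewrite ler_wpM2l.
Qed.

Definition bop_id : bop := Bop id_bounded_linear.
Definition bop_comp (A B : bop) : bop := Bop (comp_bounded_linear A B).

Lemma bop_compA : associative bop_comp.
Proof. by move=> A B C; apply: bop_eq. Qed.
Lemma bop_comp1l : left_id bop_id bop_comp.
Proof. by move=> A; apply: bop_eq. Qed.
Lemma bop_comp1r : right_id bop_id bop_comp.
Proof. by move=> A; apply: bop_eq. Qed.
Lemma bop_compDl : left_distributive bop_comp +%R.
Proof. by move=> A B C; apply: bop_eq. Qed.
Lemma bop_compDr : right_distributive bop_comp +%R.
Proof. by move=> A B C; apply: bop_eq => x; rewrite bopD; exact: linearD. Qed.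

(* The product of B(V) is composition and its unit is the identity operator. *)
HB.instance Definition _ := GRing.Zmodule_isPzRing.Build bop
  bop_compA bop_comp1l bop_comp1r bop_compDl bop_compDr.

Lemma bopM (A B : bop) x : (A * B) x = A (B x). Proof. by []. Qed.

Lemma bop1 x : (1 : bop) x = x. Proof. by []. Qed.

Definition opnorm (A : bop) : R :=
  sup [set rnorm (A x) | x in [set x : V | rnorm x <= 1]].

Lemma opnorm_has_sup (A : bop) :
  has_sup [set rnorm (A x) | x in [set x : V | rnorm x <= 1]].
Proof.
split; first by exists (rnorm (A 0)), 0 => //=; rewrite rnorm0.
have /asboolP[_ [M AM]] := bopP A; exists `|M| => _ [x /= x1 <-].
rewrite (le_trans (AM x))// (@le_trans _ _ (`|M| * rnorm x))//.
  by rewrite ler_wpM2r ?ler_norm ?rnorm_ge0.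
by rewrite ler_piMr.
Qed.

Lemma opnorm_ge0 (A : bop) : 0 <= opnorm A.
Proof.
apply: (le_trans (rnorm_ge0 (A 0))); apply: ub_le_sup.
  by case: (opnorm_has_sup A).
by exists 0; rewrite //= rnorm0.
Qed.

Lemma le_opnorm (A : bop) x : rnorm (A x) <= opnorm A * rnorm x.
Proof.
have [->|x0] := eqVneq x 0.
  by rewrite linear0 !rnorm0 mulr0.
have rx0 : 0 < rnorm x by rewrite -ltcR rnormE normr_gt0.
rewrite -ler_pdivrMr// mulrC.
have rE : `|(rnorm x)^-1%:C| = (rnorm x)^-1%:C.
  by rewrite ger0_norm// lecR invr_ge0 ltW.
rewrite -(rnormZ (A x) rE) -linearZ /=.
apply: ub_le_sup; first by case: (opnorm_has_sup A).
exists ((rnorm x)^-1%:C *: x) => //=.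
by rewrite (rnormZ _ rE) mulVf ?gt_eqF.
Qed.

Lemma opnorm_le (A : bop) M :
  0 <= M -> (forall x, rnorm (A x) <= M * rnorm x) -> opnorm A <= M.
Proof.
move=> M0 AM; apply: ge_sup; first by case: (opnorm_has_sup A).
by move=> _ [x /= x1 <-]; rewrite (le_trans (AM x))// ler_piMr.
Qed.

Lemma opnormD (A B : bop) : (opnorm (A + B))%:C <= (opnorm A)%:C + (opnorm B)%:C.
Proof.
rewrite -rmorphD lecR; apply: opnorm_le => [|x].
  by rewrite addr_ge0 ?opnorm_ge0.
rewrite mulrDl (@le_trans _ _ (rnorm (A x) + rnorm (B x)))//.
  by rewrite bopD -lecR rmorphD /= !rnormE ler_normD.
by rewrite lerD ?le_opnorm.
Qed.

Lemma opnormZ a (A : bop) : (opnorm (a *: A))%:C = `|a| * (opnorm A)%:C.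
Proof.
have [r r0 ar] := normC_real a; rewrite ar -rmorphM /=; congr (_%:C).
apply/eqP; rewrite eq_le; apply/andP; split.
  apply: opnorm_le => [|x]; first by rewrite mulr_ge0 ?opnorm_ge0.
  by rewrite bopZ (rnormZ _ ar) -mulrA ler_wpM2l ?le_opnorm.
have [->|rz] := eqVneq r 0; first by rewrite mul0r opnorm_ge0.
have rp : 0 < r by rewrite lt_neqAle eq_sym rz.
rewrite mulrC -ler_pdivlMr//; apply: opnorm_le => [|x].
  by rewrite divr_ge0 ?opnorm_ge0.
by rewrite mulrAC ler_pdivlMr// mulrC -(rnormZ _ ar) -bopZ le_opnorm.
Qed.

Lemma opnorm0_eq0 (A : bop) : (opnorm A)%:C = 0 -> A = 0.
Proof.
move=> /complexI A0; apply: bop_eq => x; apply/eqP; rewrite -normr_eq0.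
by rewrite eq_le normr_ge0 andbT -rnormE lecR -[leRHS](mul0r (rnorm x)) -A0 le_opnorm.
Qed.

HB.instance Definition _ :=
  Lmodule_isNormed.Build R[i] bop opnormD opnormZ opnorm0_eq0.

Lemma bop_rnormE (A : bop) : rnorm A = opnorm A. Proof. by []. Qed.

End BoundedOperators.

Section HilbertOperators.
Variables (R : realType) (H : hilbertType R).
Implicit Types (A P : bop H).

(* The adjoint, and the positive square root of a positive operator, exist and
   are unique, so that the default value 0 of xget is irrelevant. *)
Definition adjoint A : bop H :=
  xget 0 [set B : bop H | forall x y : H, hdot (A x) y = hdot x (B y)].

(* In R[i], 0 <= z means that z is real and nonnegative. *)
Definition positive_op P : Prop := forall x : H, 0 <= hdot (P x) x.

Definition sqrt_op P : bop H :=
  xget 0 [set S : bop H | positive_op S /\ S ^+ 2 = P].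

Definition abs_op A : bop H := sqrt_op (adjoint A * A).

Definition numerical_radius A : R :=
  sup [set complex.Re `|hdot (A x) x| | x in [set x : H | rnorm x = 1]].

End HilbertOperators.

Section RiemannIntegral.
Variables (R : realType) (V : normedModType R[i]).
Implicit Types (a b : R) (s : seq R) (c : nat -> R) (F : R -> V).

(* The subdivision a = s_0 < s_1 < ... < s_n = b is encoded, as in
   itv_partition, by its tail [:: s_1; ...; s_n]; c i is the tag of
   [s_i, s_(i+1)]. *)
Definition riemann_sum F a b s c : V :=
  \sum_(i < size s) (nth b s i - nth b (a :: s) i)%:C *: F (c i).

Definition is_riemann_integral F a b (v : V) : Prop :=
  forall e : R, 0 < e -> exists2 d : R, 0 < d &
    forall s c, itv_partition a b s ->
      (forall i, (i < size s)%N -> nth b s i - nth b (a :: s) i < d) ->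
      (forall i, (i < size s)%N -> nth b (a :: s) i <= c i <= nth b s i) ->
      rnorm (riemann_sum F a b s c - v) < e.

(* The limit is unique when a < b. *)
Definition riemann_integral F a b : V :=
  xget 0 [set v | is_riemann_integral F a b v].

End RiemannIntegral.

(* Main.v *)
(* For a unit vector x, the mixed Schwarz inequality
   |<A x, x>|^2 <= <|A| x, x> <|A*| x, x> and |<A x, x>|^2 <= |A x|^2 = <|A|^2 x, x>
   combine into q^2 <= <S x, x> with q = |<A x, x>|. The integral equals
   J = (S^2 + w^2 S + w^4) / 3, and <S^2 x, x> >= <S x, x>^2, so
   |J| >= <J x, x> >= (q^4 + w^2 q^2 + w^4) / 3 >= q^4; the supremum over x is the
   first inequality. The second follows from w^2 <= |S| and the triangle
   inequality. *)
Require Import Defs.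
From mathcomp Require Import all_boot all_order all_algebra.
From mathcomp Require Import complex.
From mathcomp Require Import all_classical all_reals all_analysis.
From mathcomp Require Import ring lra.
Set Implicit Arguments.
Unset Strict Implicit.
Unset Printing Implicit Defensive.
Import Order.TTheory GRing.Theory Num.Theory.
Import numFieldNormedType.Exports.
Local Open Scope classical_set_scope.
Local Open Scope ring_scope.
Local Open Scope complex_scope.

(** The adjoint and the square root are chosen by [xget], so nothing is known about them until
    existence is proved, and existence has to come from completeness. One minimization argument
    yields both the adjoint and the solvability of [P u + e u = x]; an iteration dominated by a
    scalar one yields the square root. The mixed Schwarz inequality is usually derived from the
    polar decomposition. Here the relation [|A*| A = A |A|] takes its place, and the shift by
    [e > 0] replaces the inverse that [|A|] may lack. That relation is itself obtained without
    functional calculus, from an argument on positive square roots. Every limit comes with an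
    explicit bound [K / (n + 1)], so that passing to the limit reduces to the Archimedean property
    in [archi_le0]. *)

Section RealParts.
Variable R : realType.
Implicit Types z : R[i].

Definition cabs z : R := complex.Re `|z|.

Lemma cabsE z : (cabs z)%:C = `|z|.
Proof. by rewrite RRe_real // normr_real. Qed.

Lemma cabs_ge0 z : 0 <= cabs z.
Proof. by rewrite -lecR cabsE normr_ge0. Qed.

Lemma cReM (z1 z2 : R[i]) : complex.Re (z1 * z2) =
  complex.Re z1 * complex.Re z2 - complex.Im z1 * complex.Im z2.
Proof. by case: z1; case: z2. Qed.

Lemma cImM (z1 z2 : R[i]) : complex.Im (z1 * z2) =
  complex.Re z1 * complex.Im z2 + complex.Im z1 * complex.Re z2.
Proof. by case: z1 => ? ?; case: z2. Qed.

Lemma cReD (z1 z2 : R[i]) :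
  complex.Re (z1 + z2) = complex.Re z1 + complex.Re z2.
Proof. by case: z1; case: z2. Qed.

Lemma cImD (z1 z2 : R[i]) :
  complex.Im (z1 + z2) = complex.Im z1 + complex.Im z2.
Proof. by case: z1; case: z2. Qed.

Lemma cReN z : complex.Re (- z) = - complex.Re z.
Proof. by case: z. Qed.

Lemma cRe_conj z : complex.Re (Num.conj z) = complex.Re z.
Proof. by case: z. Qed.

Lemma cIm_conj z : complex.Im (Num.conj z) = - complex.Im z.
Proof. by case: z. Qed.

Lemma complex_ext (z1 z2 : R[i]) : complex.Re z1 = complex.Re z2 ->
  complex.Im z1 = complex.Im z2 -> z1 = z2.
Proof. by case: z1 => a b; case: z2 => c d /= -> ->. Qed.

Lemma complex_ge0 z : (0 <= z) = (0 <= complex.Re z) && (complex.Im z == 0).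
Proof. by case: z => a b; rewrite lecE /= andbC. Qed.

Lemma archi_le0 (a K : R) : (forall n, a <= K / n.+1%:R) -> a <= 0.
Proof.
move=> aK; rewrite leNgt; apply/negP => a0.
have := aK (Num.truncn (K / a)); rewrite leNgt => /negP; apply.
rewrite ltr_pdivrMr// mulrC -ltr_pdivrMr//.
exact: truncnS_gt.
Qed.

End RealParts.

(** * Real-valued norm, and completeness with a rate *)

Section RealNormTheory.
Variables (R : realType) (V : normedModType R[i]).
Implicit Types x y : V.

Lemma rnormD x y : rnorm (x + y) <= rnorm x + rnorm y.
Proof. by rewrite -lecR rmorphD /= !rnormE ler_normD. Qed.

Lemma rnormN x : rnorm (- x) = rnorm x.
Proof. by rewrite /rnorm normrN. Qed.

Lemma rnormB x y : rnorm (x - y) <= rnorm x + rnorm y.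
Proof. by rewrite -[rnorm y]rnormN rnormD. Qed.

Lemma rnormC x y : rnorm (x - y) = rnorm (y - x).
Proof. by rewrite -rnormN opprB. Qed.

Lemma rnormDB z x y : rnorm (x - y) <= rnorm (x - z) + rnorm (z - y).
Proof. by rewrite -[x - y](subrKA z) rnormD. Qed.

Lemma rnormZc (a : R[i]) x : rnorm (a *: x) = cabs a * rnorm x.
Proof. by apply: rnormZ; rewrite cabsE. Qed.

Lemma rnormZr (r : R) x : rnorm (r%:C *: x) = `|r| * rnorm x.
Proof.
rewrite rnormZc; congr (_ * _); apply: complexI.
by rewrite cabsE normc_def /= expr0n addr0 sqrtr_sqr.
Qed.

Lemma rnorm_le0 x : rnorm x <= 0 -> x = 0.
Proof.
move=> x0; apply/eqP; rewrite -normr_eq0 eq_le normr_ge0 andbT -rnormE.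
by rewrite -[0]/(0%:C) lecR.
Qed.

Lemma rnorm_gt0 x : x != 0 -> 0 < rnorm x.
Proof. by rewrite ltNge; apply: contraNN => /rnorm_le0 ->. Qed.

End RealNormTheory.

Lemma complete_rate (R : realType) (V : completeNormedModType R[i])
    (u : nat -> V) (K : R) :
  (forall n m, (n <= m)%N -> rnorm (u m - u n) <= K / n.+1%:R) ->
  exists l, forall n, rnorm (l - u n) <= K / n.+1%:R.
Proof.
move=> uK.
have K0 : 0 <= K by have := uK 0 0 isT; rewrite subrr rnorm0 divr1.
have small (e : R) : 0 < e -> exists N, forall n, (N <= n)%N -> K / n.+1%:R < e.
  move=> e0; exists (Num.truncn (K / e)) => n Nn.
  rewrite ltr_pdivrMr// mulrC -ltr_pdivrMr// (lt_le_trans (truncnS_gt _))//.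
  by rewrite ler_nat.
have /cauchy_cvg/cvg_ex[l ul] : cauchy (u @ \oo).
  apply/cauchy_ballP => /= e e0.
  have [er re0] : exists2 er : R, 0 < er & er%:C = e.
    move: e0; case: e => a b; rewrite ltcE /= => /andP[/eqP -> a0].
    by exists a.
  move=> ere; have [N Ne] := small _ re0.
  have half : \forall n \near \oo, (N <= n)%N by exact: nbhs_infty_ge.
  exists ([set u n | n in [set n | (N <= n)%N]], [set u n | n in [set n | (N <= n)%N]]).
    by split => /=; apply: filterS half => n Nn; exists n.
  move=> [_ _] /= [[n Nn <-] [m Nm <-]].
  rewrite -ball_normE /= -ere -rnormE ltcR.
  have [nm|mn] := leqP n m.
    by rewrite rnormC (le_lt_trans (uK _ _ nm))// Ne.
  by rewrite (le_lt_trans (uK _ _ (ltnW mn)))// Ne.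
exists l => n; apply/ler_addgt0Pr => e e0.
have e0' : 0 < e%:C :> R[i] by rewrite ltcR.
move/cvgrPdist_lt : ul => /(_ _ e0') [N _ ul].
have := ul (maxn N n) (leq_maxl _ _).
rewrite -rnormE ltcR => lu.
apply: (le_trans (rnormDB (u (maxn N n)) _ _)).
rewrite addrC lerD ?uK ?leq_maxr//.
exact: ltW.
Qed.

(** * The inner product and its real part *)

Section InnerProduct.
Variables (R : realType) (H : hilbertType R).
Implicit Types (x y z : H) (a : R[i]) (r : R).

Lemma hdotC x y : hdot y x = Num.conj (hdot x y).
Proof. by rewrite hermC mul1r. Qed.

Lemma hdotDl x y z : hdot (x + y) z = hdot x z + hdot y z.
Proof. exact: linearDl. Qed.

Lemma hdotDr x y z : hdot x (y + z) = hdot x y + hdot x z.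
Proof. exact: linearDr. Qed.

Lemma hdotZl a x y : hdot (a *: x) y = a * hdot x y.
Proof. exact: linearZl_LR. Qed.

Lemma hdotZr a x y : hdot x (a *: y) = Num.conj a * hdot x y.
Proof. exact: linearZr_LR. Qed.

Lemma hdotNl x y : hdot (- x) y = - hdot x y.
Proof. exact: linearNl. Qed.

Lemma hdotNr x y : hdot x (- y) = - hdot x y.
Proof. exact: linearNr. Qed.

Lemma hdot0l y : hdot 0 y = 0.
Proof. exact: linear0l. Qed.

Definition rdot x y : R := complex.Re (hdot x y).

Lemma rdotC x y : rdot x y = rdot y x.
Proof. by rewrite /rdot hdotC cRe_conj. Qed.

Lemma rdotDl x y z : rdot (x + y) z = rdot x z + rdot y z.
Proof. by rewrite /rdot hdotDl cReD. Qed.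

Lemma rdotDr x y z : rdot x (y + z) = rdot x y + rdot x z.
Proof. by rewrite /rdot hdotDr cReD. Qed.

Lemma rdotNl x y : rdot (- x) y = - rdot x y.
Proof. by rewrite /rdot hdotNl cReN. Qed.

Lemma rdotNr x y : rdot x (- y) = - rdot x y.
Proof. by rewrite /rdot hdotNr cReN. Qed.

Lemma rdotZl r x y : rdot (r%:C *: x) y = r * rdot x y.
Proof. by rewrite /rdot hdotZl cReM /= mul0r subr0. Qed.

Lemma rdotZr r x y : rdot x (r%:C *: y) = r * rdot x y.
Proof. by rewrite rdotC rdotZl rdotC. Qed.

Lemma rdot0l y : rdot 0 y = 0.
Proof. by rewrite /rdot hdot0l. Qed.

Lemma rdotxx x : rdot x x = rnorm x ^+ 2.
Proof.
by rewrite /rdot hdot_norm -rnormE -rmorphXn.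
Qed.

Definition rdotE := (rdotDl, rdotDr, rdotNl, rdotNr, rdotZl, rdotZr).

Lemma Im_hdot x y : complex.Im (hdot x y) = rdot x ('i%C *: y).
Proof. by rewrite /rdot hdotZr cReM /=; ring. Qed.

(** The imaginary part of a product is the real part after [y] is multiplied by i. For maps that
    commute with complex scalars, an identity of real parts is therefore an identity of complex
    products, so computations can stay with [rdot]. *)
Lemma rdot_eq (f g : H -> H) :
  (forall a x, f (a *: x) = a *: f x) -> (forall a x, g (a *: x) = a *: g x) ->
  (forall x y, rdot (f x) y = rdot x (g y)) ->
  forall x y, hdot (f x) y = hdot x (g y).
Proof.
move=> fZ gZ fg x y; apply: complex_ext; first exact: fg.
by rewrite !Im_hdot fg gZ.
Qed.

Lemma rdot_ext x y : (forall z, rdot x z = rdot y z) -> x = y.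
Proof.
move=> xy; apply/eqP; rewrite -subr_eq0; apply/eqP/rnorm_le0.
rewrite -(@ler_pXn2r _ 2) ?nnegrE ?rnorm_ge0// -rdotxx rdotDl rdotNl xy subrr.
by rewrite expr0n.
Qed.

End InnerProduct.

(** * Positive operators and the Cauchy-Schwarz inequality *)

Section PositiveOperators.
Variables (R : realType) (H : hilbertType R).
Implicit Types (x y z : H) (A B P X : bop H).

Definition selfadjoint_op A := forall x y, rdot (A x) y = rdot x (A y).

Lemma bopN A x : (- A) x = - A x. Proof. by []. Qed.

Lemma bop_appD A x y : A (x + y) = A x + A y.
Proof. exact: linearD. Qed.

Lemma bop_appB A x y : A (x - y) = A x - A y.
Proof. exact: linearB. Qed.

Lemma bop_appZ (a : R[i]) A x : A (a *: x) = a *: A x.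
Proof. exact: linearZ. Qed.

Lemma positive_rdot_ge0 P x : positive_op P -> 0 <= rdot (P x) x.
Proof. by move=> /(_ x); rewrite complex_ge0 => /andP[]. Qed.

(* Polarization: the diagonal values of the form at x + y and x + iy are real. *)
Lemma positive_selfadjoint P : positive_op P -> selfadjoint_op P.
Proof.
move=> P0 x y.
have Im0 z : complex.Im (hdot (P z) z) = 0.
  by have := P0 z; rewrite complex_ge0 => /andP[_ /eqP].
have := Im0 (x + 'i%C *: y).
rewrite bop_appD bop_appZ !(hdotDl, hdotDr, hdotZl, hdotZr) !(cImD, cImM, cReM) /=.
rewrite !Im0 [rdot x _]rdotC /rdot.
lra.
Qed.

Lemma selfadjoint_rdot_ge0_positive P : selfadjoint_op P ->
  (forall x, 0 <= rdot (P x) x) -> positive_op P.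
Proof.
move=> sP P0 x; rewrite complex_ge0; apply/andP; split; first exact: P0.
have := rdot_eq (fun a => bop_appZ a P) (fun a => bop_appZ a P) sP x x.
rewrite [in RHS]hdotC => /(congr1 (@complex.Im R)); rewrite cIm_conj => /eqP.
by rewrite -addr_eq0 -mulr2n mulrn_eq0.
Qed.

Lemma quadratic_ge0_bound (a b k : R) : 0 <= a -> 0 <= b ->
  (forall t, 0 <= a - 2 * t * k + t ^+ 2 * b) -> k ^+ 2 <= a * b.
Proof.
move=> a0 b0 ab; have [b_eq0|bn0] := eqVneq b 0.
  have [->|k0] := eqVneq k 0; first by rewrite expr0n /= mulr_ge0.
  (* With [b = 0] the polynomial is affine in t; at this point it equals -1. *)
  have := ab ((a + 1) / (2 * k)).
  have -> : 2 * ((a + 1) / (2 * k)) * k = a + 1 by field.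
  rewrite b_eq0; lra.
have bp : 0 < b by rewrite lt_neqAle eq_sym bn0.
have := ab (k / b).
have -> : a - 2 * (k / b) * k + (k / b) ^+ 2 * b = (a * b - k ^+ 2) / b by field.
by rewrite pmulr_lge0 ?invr_gt0// subr_ge0.
Qed.

Lemma positive_CS P x y : positive_op P ->
  rdot (P x) y ^+ 2 <= rdot (P x) x * rdot (P y) y.
Proof.
move=> P0; apply: quadratic_ge0_bound; try exact: positive_rdot_ge0.
move=> t; have := positive_rdot_ge0 (x - t%:C *: y) P0.
rewrite bop_appB bop_appZ !rdotE [rdot (P y) x]rdotC -(positive_selfadjoint P0).
lra.
Qed.

Lemma positive_op1 : positive_op (1 : bop H).
Proof. by move=> x; rewrite bop1 hdot_norm exprn_ge0. Qed.

Lemma positive_opD P Q : positive_op P -> positive_op Q -> positive_op (P + Q).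
Proof. by move=> P0 Q0 x; rewrite bopD hdotDl addr_ge0. Qed.

Lemma positive_opZ (r : R) P : 0 <= r -> positive_op P -> positive_op (r%:C *: P).
Proof. by move=> r0 P0 x; rewrite bopZ hdotZl mulr_ge0// -[0]/(0%:C) lecR. Qed.

Lemma rdot_CS x y : `|rdot x y| <= rnorm x * rnorm y.
Proof.
rewrite -(@ler_pXn2r _ 2) ?nnegrE ?mulr_ge0 ?rnorm_ge0// exprMn.
rewrite -!rdotxx -normrX ger0_norm ?sqr_ge0//.
exact: (positive_CS _ _ positive_op1).
Qed.

Lemma rdot_le_opnorm A x : rdot (A x) x <= opnorm A * rnorm x ^+ 2.
Proof.
rewrite (le_trans (ler_norm _))// (le_trans (rdot_CS _ _))// expr2 mulrA.
by rewrite ler_wpM2r ?rnorm_ge0// le_opnorm.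
Qed.

Lemma rnorm_le_rdot x (r : R) : 0 <= r -> rdot x x <= r * rnorm x -> rnorm x <= r.
Proof.
move=> r0; have [->|x0] := eqVneq x 0; first by rewrite rnorm0.
by rewrite rdotxx expr2 ler_pM2r// rnorm_gt0.
Qed.

Lemma selfadjoint_sqr A x : selfadjoint_op A ->
  rdot ((A ^+ 2) x) x = rnorm (A x) ^+ 2.
Proof. by move=> sA; rewrite expr2 bopM sA rdotxx. Qed.

(** Cauchy-Schwarz for the form of [P] at the pair x, P x gives [|P x|^4 <= <P x, x> <P P x, P x> <=
    r |x|^2 r |P x|^2]; then divide by [|P x|^2]. *)
Lemma positive_opnorm_le P (r : R) : positive_op P -> 0 <= r ->
  (forall x, rdot (P x) x <= r * rnorm x ^+ 2) -> opnorm P <= r.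
Proof.
move=> P0 r0 Pr; apply: opnorm_le => // x.
have [Px0|Px0] := eqVneq (P x) 0; first by rewrite Px0 rnorm0 mulr_ge0 ?rnorm_ge0.
have n0 := rnorm_gt0 Px0.
have := positive_CS x (P x) P0; rewrite rdotxx => h.
rewrite -(@ler_pXn2r _ 2) ?nnegrE ?mulr_ge0 ?rnorm_ge0//.
rewrite -(@ler_pM2r _ (rnorm (P x) ^+ 2)) ?exprn_gt0// -expr2.
apply: (le_trans h); rewrite exprMn expr2 -!mulrA mulrA.
apply: (@le_trans _ _ ((r * rnorm x ^+ 2) * (r * rnorm (P x) ^+ 2))).
  by apply: ler_pM; rewrite ?positive_rdot_ge0.
by rewrite le_eqVlt; apply/orP; left; apply/eqP; ring.
Qed.

(** Multiplying [x] by the conjugate of [z] makes the product real, equal to [|z|^2]. The real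
    inequality then reads [|z|^4 <= |z|^2 <P x, x> <P y, y>]. *)
Lemma cabs_positive_CS P x y : positive_op P ->
  cabs (hdot (P x) y) ^+ 2 <= rdot (P x) x * rdot (P y) y.
Proof.
move=> P0; set z := hdot (P x) y; have [z0|z0] := eqVneq (cabs z) 0.
  by rewrite z0 expr0n mulr_ge0 ?positive_rdot_ge0.
have zE : Num.conj z * z = (cabs z ^+ 2)%:C.
  by rewrite mulrC -normCK rmorphXn /= cabsE.
have qE : rdot (P (Num.conj z *: x)) (Num.conj z *: x)
    = cabs z ^+ 2 * rdot (P x) x.
  rewrite bop_appZ /rdot hdotZl hdotZr conjCK mulrA zE cReM /=.
  by rewrite mul0r subr0.
have lE : rdot (P (Num.conj z *: x)) y = cabs z ^+ 2.
  by rewrite bop_appZ /rdot hdotZl -/z zE.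
have zp : 0 < cabs z ^+ 2 by rewrite exprn_gt0// lt_neqAle eq_sym z0 cabs_ge0.
have := positive_CS (Num.conj z *: x) y P0.
by rewrite qE lE expr2 -mulrA ler_pM2l.
Qed.

End PositiveOperators.

(** * Representation of functionals, adjoints, and the equation P u + e u = x *)

Section Riesz.
Variables (R : realType) (H : hilbertType R).
Implicit Types (x y z h : H) (A B P Q X : bop H).

(* The quadratic functional u |-> <Q u, u> - 2 g u is strongly convex, so its
   minimizing sequences are Cauchy; u is its minimizer. *)
Lemma coercive_representation Q (c M : R) (g : H -> R) :
  positive_op Q -> 0 < c -> (forall x, c * rnorm x ^+ 2 <= rdot (Q x) x) ->
  (forall x y, g (x + y) = g x + g y) ->
  (forall (r : R) x, g (r%:C *: x) = r * g x) ->
  (forall x, g x <= M * rnorm x) ->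
  exists u, forall h, g h = rdot (Q u) h.
Proof.
move=> Q0 c0 Qc gD gZ gM; have sQ := positive_selfadjoint Q0.
pose J x := rdot (Q x) x - 2 * g x.
have JD x y : J (x + y) = J x + rdot (Q y) y + 2 * (rdot (Q x) y - g y).
  by rewrite /J gD bop_appD !rdotE [rdot (Q y) x]sQ [rdot y _]rdotC; ring.
have Jlb x : - (M ^+ 2 / c) <= J x.
  rewrite -[leLHS]mulN1r -subr_ge0.
  have -> : J x - -1 * (M ^+ 2 / c) = (rdot (Q x) x - c * rnorm x ^+ 2)
      + 2 * (M * rnorm x - g x) + (c * rnorm x - M) ^+ 2 / c.
    by rewrite /J; field; rewrite gt_eqF.
  apply: addr_ge0; last by rewrite divr_ge0 ?sqr_ge0 ?ltW.
  by rewrite addr_ge0 ?mulr_ge0 ?subr_ge0.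
pose m := inf [set J x | x in [set: H]].
have Jinf : has_inf [set J x | x in [set: H]].
  by split; [exists (J 0), 0|exists (- (M ^+ 2 / c)) => _ [x _ <-]].
have mJ x : m <= J x by apply: ge_inf; [case: Jinf|exists x].
(* The tolerance is fitted to [strong]: two such terms, each doubled, add up to at most
   [c / (n + 1)^2], so the sequence is Cauchy with rate [1 / (n + 1)]. *)
have /choice[u uP] (n : nat) : exists x, J x < m + c / 4 * (1 / n.+1%:R) ^+ 2.
  have e0 : 0 < c / 4 * (1 / n.+1%:R) ^+ 2.
    by rewrite mulr_gt0 ?divr_gt0 ?exprn_gt0 ?divr_gt0.
  by have [_ [x _ <-] xlt] := inf_adherent e0 Jinf; exists x.
(* Parallelogram identity: [<Q (x - y), x - y>] is [2 J x + 2 J y] minus four times [J] at the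
   midpoint, where [J] is at least [m]. *)
have strong x y : c * rnorm (x - y) ^+ 2 <= 2 * (J x - m) + 2 * (J y - m).
  apply: (le_trans (Qc _)); have := mJ ((2^-1)%:C *: (x + y)).
  rewrite /J gZ gD bop_appB bop_appZ bop_appD !rdotE.
  rewrite [rdot (Q y) x]sQ [rdot y _]rdotC.
  lra.
have rate n k : (n <= k)%N -> 1 / k.+1%:R <= 1 / n.+1%:R :> R.
  by move=> nk; rewrite !div1r lef_pV2 ?posrE// ler_nat.
have [l ul] : exists l, forall n, rnorm (l - u n) <= 1 / n.+1%:R.
  apply: complete_rate => n k nk.
  rewrite -(@ler_pXn2r _ 2) ?nnegrE ?rnorm_ge0 ?divr_ge0//.
  rewrite -(ler_pM2l c0); apply: (le_trans (strong _ _)).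
  have knE : (1 / k.+1%:R) ^+ 2 <= (1 / n.+1%:R) ^+ 2 :> R.
    by rewrite ler_pXn2r ?nnegrE ?divr_ge0 ?rate.
  have := uP n; have := uP k; have := ler_wpM2l (ltW c0) knE.
  move: (_ ^+ 2) (_ ^+ 2) => p q.
  lra.
exists l => h; apply/eqP; rewrite eq_sym -subr_eq0.
(* First variation: [2 t L + t^2 <Q h, h> >= 0] for all t is the discriminant bound with [a = 0],
   which forces [L = 0]. It is read off from [m <= J (u n + t h)]; the error consists of
   [J (u n) - m] and the cost of replacing [u n] by [l]. *)
set L := rdot (Q l) h - g h.
suff : (- L) ^+ 2 <= 0 * rdot (Q h) h.
  by rewrite mul0r sqrrN => L0; rewrite -sqrf_eq0 eq_le L0 sqr_ge0.
apply: quadratic_ge0_bound => // [|t]; first exact: positive_rdot_ge0.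
rewrite -oppr_le0.
apply: (@archi_le0 _ _ (c / 4 + 2 * `|t| * (opnorm Q * rnorm h))) => n.
have mn := mJ (u n + t%:C *: h); rewrite JD bop_appZ !rdotE gZ in mn.
have LnE : rdot (Q l) h - rdot (Q (u n)) h = rdot (Q (l - u n)) h.
  by rewrite bop_appB !rdotE.
have : `|t * rdot (Q (l - u n)) h| <= `|t| * (opnorm Q * rnorm h) / n.+1%:R.
  rewrite normrM -mulrA ler_wpM2l// (le_trans (rdot_CS _ _))//.
  rewrite mulrAC ler_wpM2r ?rnorm_ge0// (le_trans (le_opnorm _ _))//.
  by rewrite ler_wpM2l ?opnorm_ge0// -div1r.
rewrite -LnE => /ler_normlP[tn _].
have sqle : c / 4 * (1 / n.+1%:R) ^+ 2 <= c / 4 / n.+1%:R.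
  apply: ler_wpM2l; first by rewrite divr_ge0 ?ltW.
  rewrite -[leRHS]div1r expr2 ler_piMr ?divr_ge0//.
  by have := rate 0%N n isT; rewrite divr1.
have := uP n; rewrite /L; move: sqle tn; rewrite !div1r; move: (n.+1%:R^-1) => i.
lra.
Qed.

Lemma rdotZ_conj (a : R[i]) x y : rdot x (a *: y) = rdot (Num.conj a *: x) y.
Proof. by rewrite /rdot hdotZr hdotZl. Qed.

Lemma adjoint_exists A :
  exists B : bop H, forall x y, hdot (A x) y = hdot x (B y).
Proof.
have /choice[B BP] (y : H) : exists u, forall h, rdot (A h) y = rdot u h.
  have := @coercive_representation 1 1 (opnorm A * rnorm y)
    (fun h => rdot (A h) y) (@positive_op1 R H) ltr01.
  apply => [x|x x'|r x|x].
  - by rewrite mul1r rdotxx.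
  - by rewrite bop_appD rdotDl.
  - by rewrite bop_appZ rdotZl.
  - rewrite (le_trans (ler_norm _))// (le_trans (rdot_CS _ _))// mulrAC.
    by rewrite ler_wpM2r ?rnorm_ge0 ?le_opnorm.
(* The representing vectors come from real functionals; complex linearity is recovered by moving the
   scalar across the product. *)
have linB : linear B.
  move=> a x y; apply: rdot_ext => h.
  rewrite -BP rdotDr rdotZ_conj -bop_appZ !BP rdotDl.
  by rewrite rdotZ_conj conjCK.
have bB : B \in @bounded_linear_pred R H.
  apply/asboolP; split=> //; exists (opnorm A) => y.
  apply: rnorm_le_rdot; first by rewrite mulr_ge0 ?opnorm_ge0 ?rnorm_ge0.
  rewrite -BP (le_trans (ler_norm _))// (le_trans (rdot_CS _ _))// mulrAC.
  by rewrite ler_wpM2r ?rnorm_ge0 ?le_opnorm.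
exists (Bop bB).
apply: rdot_eq => [a x|a x|x y]; first exact: bop_appZ.
- exact: (bop_appZ _ (Bop bB)).
- by rewrite BP rdotC.
Qed.

Lemma adjointP A x y : hdot (A x) y = hdot x (adjoint A y).
Proof.
have [B BP] := adjoint_exists A.
have := @xgetPex _ (0 : bop H) [set B : bop H | forall x y, hdot (A x) y = hdot x (B y)].
by apply; exists B.
Qed.

Lemma rdot_adjoint A x y : rdot (A x) y = rdot x (adjoint A y).
Proof. by rewrite /rdot adjointP. Qed.

Lemma adjoint_unique A B : (forall x y, rdot (A x) y = rdot x (B y)) ->
  adjoint A = B.
Proof.
move=> AB; apply: bop_eq => y; apply: rdot_ext => x.
by rewrite rdotC -rdot_adjoint AB rdotC.
Qed.

Lemma adjointK A : adjoint (adjoint A) = A.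
Proof.
by apply: adjoint_unique => x y; rewrite rdotC -rdot_adjoint rdotC.
Qed.

Lemma positive_adjointM A : positive_op (adjoint A * A).
Proof.
by move=> x; rewrite bopM hdotC -adjointP -hdotC hdot_norm exprn_ge0.
Qed.

Lemma rdot_adjointM A x : rdot ((adjoint A * A) x) x = rnorm (A x) ^+ 2.
Proof. by rewrite bopM rdotC -rdot_adjoint rdotxx. Qed.

(** [P + e] is coercive with constant [e], so it represents the functional [rdot x]. *)
Lemma positive_shift_surj P (e : R) x : positive_op P -> 0 < e ->
  exists u, P u + e%:C *: u = x.
Proof.
move=> P0 e0; have PeE u : P u + e%:C *: u = (P + e%:C *: (1 : bop H)) u by [].
have Pe0 : positive_op (P + e%:C *: (1 : bop H)).
  by apply: positive_opD => //; apply: positive_opZ; [exact: ltW|exact: positive_op1].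
have [u uP] : exists u, forall h, rdot x h = rdot ((P + e%:C *: (1 : bop H)) u) h.
  apply: (@coercive_representation _ e (rnorm x)) => // [y|y z|r y|y].
  - rewrite bopD bopZ bop1 rdotDl rdotZl rdotxx lerDr.
    exact: positive_rdot_ge0.
  - exact: rdotDr.
  - exact: rdotZr.
  - exact: le_trans (ler_norm _) (rdot_CS _ _).
by exists u; rewrite PeE; apply: rdot_ext => h; rewrite uP.
Qed.
End Riesz.

(** The pointwise limits keep the rate with constant [K * rnorm x]; since it is linear in the norm
    of [x], it is again a bound on the operator norm. *)
Lemma bop_complete_rate (R : realType) (V : completeNormedModType R[i])
    (u : nat -> bop V) (K : R) :
  (forall n m, (n <= m)%N -> opnorm (u m - u n) <= K / n.+1%:R) ->
  exists L : bop V, forall n, opnorm (L - u n) <= K / n.+1%:R.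
Proof.
move=> uK.
have K0 : 0 <= K by have := uK 0 0 isT; rewrite divr1; exact: le_trans (opnorm_ge0 _).
have /choice[L LP] (x : V) :
    exists l, forall n, rnorm (l - u n x) <= (K * rnorm x) / n.+1%:R.
  apply: complete_rate => n m nm.
  rewrite (le_trans (le_opnorm (u m - u n) x))// mulrAC.
  by rewrite ler_wpM2r ?rnorm_ge0 ?uK.
have linL : linear L.
  move=> a x y; apply/eqP; rewrite -subr_eq0; apply/eqP/rnorm_le0.
  apply: (@archi_le0 _ _
    (K * rnorm (a *: x + y) + (cabs a * (K * rnorm x) + K * rnorm y))) => n.
  have -> : L (a *: x + y) - (a *: L x + L y) =
      (L (a *: x + y) - u n (a *: x + y)) -
      (a *: (L x - u n x) + (L y - u n y)).
    rewrite (bop_linear (u n)) scalerBr [X in _ - _ - X]addrACA -opprD opprB.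
    by rewrite addrA subrK.
  rewrite (le_trans (rnormB _ _))// !mulrDl lerD ?LP//.
  rewrite (le_trans (rnormD _ _))// lerD ?LP//.
  by rewrite rnormZc -mulrA ler_wpM2l ?cabs_ge0 ?LP.
have bL : L \in @bounded_linear_pred R V.
  apply/asboolP; split=> //; exists (K + opnorm (u 0)) => x.
  rewrite -[L x](subrK (u 0 x)) mulrDl (le_trans (rnormD _ _))//.
  by rewrite lerD ?le_opnorm//; have := LP x 0; rewrite divr1.
exists (Bop bL) => n; apply: opnorm_le => [|x]; first by rewrite divr_ge0.
by rewrite mulrAC; exact: LP.
Qed.

(** * Operators as a normed algebra *)

Section BopAlgebra.
Variables (R : realType) (V : normedModType R[i]).
Implicit Types (A B : bop V).

Lemma bop_scalerAl (a : R[i]) A B : (a *: A) * B = a *: (A * B).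
Proof. by apply: bop_eq. Qed.

Lemma bop_scalerAr (a : R[i]) A B : A * (a *: B) = a *: (A * B).
Proof. by apply: bop_eq => x; rewrite !(bopM, bopZ) linearZ. Qed.

Lemma opnorm0 : opnorm (0 : bop V) = 0.
Proof. exact: (@rnorm0 _ (bop V)). Qed.

Lemma opnormC A B : opnorm (A - B) = opnorm (B - A).
Proof. exact: (@rnormC _ (bop V)). Qed.

Lemma opnormB_le A B : opnorm (A - B) <= opnorm A + opnorm B.
Proof. exact: (@rnormB _ (bop V)). Qed.

Lemma opnormDB C A B : opnorm (A - B) <= opnorm (A - C) + opnorm (C - B).
Proof. exact: (@rnormDB _ (bop V)). Qed.

Lemma opnormD_le A B : opnorm (A + B) <= opnorm A + opnorm B.
Proof. exact: (@rnormD _ (bop V)). Qed.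

Lemma opnormZr (r : R) A : 0 <= r -> opnorm (r%:C *: A) = r * opnorm A.
Proof. by move=> r0; have := @rnormZr _ (bop V) r A; rewrite ger0_norm. Qed.

Lemma opnorm_archi_eq0 A (K : R) : (forall n, opnorm A <= K / n.+1%:R) -> A = 0.
Proof. by move=> /archi_le0/(@rnorm_le0 _ (bop V)). Qed.

Lemma opnormM A B : opnorm (A * B) <= opnorm A * opnorm B.
Proof.
apply: opnorm_le => [|x]; first by rewrite mulr_ge0 ?opnorm_ge0.
rewrite bopM (le_trans (le_opnorm _ _))// -mulrA ler_wpM2l ?opnorm_ge0//.
exact: le_opnorm.
Qed.

Lemma opnorm1_le : opnorm (1 : bop V) <= 1.
Proof. by apply: opnorm_le => // x; rewrite mul1r. Qed.

End BopAlgebra.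

(* e_n = 1 - y_n for the scalar iteration y_{n+1} = (1 + y_n^2) / 2, y_0 = 0. *)
Fixpoint sqrt_rate (R : realType) (n : nat) : R :=
  if n is k.+1 then sqrt_rate R k - sqrt_rate R k ^+ 2 / 2 else 1.

(** [e - e^2 / 2] increases with e on [0, 1], so the bound [t = 2 / (n + 2)] passes to
    [t - t^2 / 2], which is at most [2 / (n + 3)]. This decay gives a rate of order 1/n even when
    [Z] has norm exactly 1. *)
Lemma sqrt_rate_bounds (R : realType) n :
  0 <= sqrt_rate R n <= 2 / n.+2%:R.
Proof.
elim: n => [|n /andP[e0 en]] /=; first by rewrite divff// ler01 lexx.
have n0 : 0 <= n%:R :> R by [].
have t1 : 2 / n.+2%:R <= 1 :> R.
  by rewrite ler_pdivrMr// mul1r ler_nat.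
set e := sqrt_rate R n in e0 en *; set t := 2 / n.+2%:R in en t1.
apply/andP; split; first by nra.
apply: (@le_trans _ _ (t - t ^+ 2 / 2)); first by nra.
rewrite /t -subr_ge0 -[n.+3]addn3 -[n.+2]addn2 !natrD.
have -> : 2 / (n%:R + 3) - (2 / (n%:R + 2) - (2 / (n%:R + 2)) ^+ 2 / 2) =
    2 / ((n%:R + 3) * (n%:R + 2) ^+ 2) :> R.
  by field; rewrite !gt_eqF//; lra.
by rewrite divr_ge0// mulr_ge0 ?exprn_ge0//; lra.
Qed.

(** * Square roots of positive operators *)

Section SquareRoot.
Variables (R : realType) (H : hilbertType R).
Implicit Types (x y z : H) (A B P Q X Z L S : bop H).

(** A fixed point Y of [Y = (Z + Y^2) / 2] satisfies [(1 - Y)^2 = 1 - Z]. *)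
Fixpoint sqrt_iter Z (n : nat) : bop H :=
  if n is k.+1 then (2^-1)%:C *: (Z + sqrt_iter Z k * sqrt_iter Z k) else 0.

(** The scalar iteration, which is the case [Z = 1], dominates the norms because the recursion has
    nonnegative coefficients. *)
Lemma sqrt_iter_norm Z n : opnorm Z <= 1 ->
  opnorm (sqrt_iter Z n) <= 1 - sqrt_rate R n.
Proof.
move=> Z1; elim: n => [|n IHn] /=.
  by rewrite subrr; apply: opnorm_le => // x; rewrite mul0r rnorm0.
rewrite opnormZr ?invr_ge0//.
have := opnormD_le Z (sqrt_iter Z n * sqrt_iter Z n).
have := opnormM (sqrt_iter Z n) (sqrt_iter Z n).
have := opnorm_ge0 (sqrt_iter Z n); nra.
Qed.

Lemma sqr_subr A B : A * A - B * B = A * (A - B) + (A - B) * B.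
Proof. by rewrite mulrBr mulrBl addrA subrK. Qed.

(** The scalar steps dominate too: [sqr_subr] factors the difference of squares without commutation,
    with norms at most those of the scalar factorization [(y1 + y0) (y1 - y0)]. The bounds then
    telescope. *)
Lemma sqrt_iter_step Z n : opnorm Z <= 1 ->
  opnorm (sqrt_iter Z n.+1 - sqrt_iter Z n) <= sqrt_rate R n - sqrt_rate R n.+1.
Proof.
move=> Z1; elim: n => [|n IHn].
  by rewrite /= mulr0 addr0 subr0 opnormZr ?invr_ge0//; lra.
set Y := sqrt_iter Z in IHn *; set e := sqrt_rate R in IHn *.
have -> : Y n.+2 - Y n.+1 =
    (2^-1)%:C *: (Y n.+1 * (Y n.+1 - Y n) + (Y n.+1 - Y n) * Y n).
  transitivity ((2^-1)%:C *: (Z + Y n.+1 * Y n.+1)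
    - (2^-1)%:C *: (Z + Y n * Y n)) => //.
  by rewrite -scalerBr opprD addrACA subrr add0r sqr_subr.
rewrite opnormZr ?invr_ge0//.
have := opnormD_le (Y n.+1 * (Y n.+1 - Y n)) ((Y n.+1 - Y n) * Y n).
have := opnormM (Y n.+1) (Y n.+1 - Y n).
have := opnormM (Y n.+1 - Y n) (Y n).
have := sqrt_iter_norm n Z1; have := sqrt_iter_norm n.+1 Z1; rewrite -/Y -/e.
have := opnorm_ge0 (Y n.+1 - Y n).
have -> : e n.+2 = e n.+1 - e n.+1 ^+ 2 / 2 by [].
have := opnorm_ge0 (Y n); have := opnorm_ge0 (Y n.+1).
have E : e n.+1 = e n - e n ^+ 2 / 2 by [].
move: IHn E.
move: (opnorm (_ * _ + _)) (opnorm (Y n.+1 * _)) (opnorm (_ * Y n)) => p q r.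
move: (opnorm (_ - _)) (opnorm (Y n.+1)) (opnorm (Y n)) => d a b.
move: (e n.+1) (e n) => e1 e0 de E a0 b0 d0 a1 b1 rd qd pqr.
have : (a + b) * d <= (2 - e1 - e0) * (e0 - e1) by apply: ler_pM; lra.
lra.
Qed.

Lemma sqrt_iter_cauchy Z n m : opnorm Z <= 1 -> (n <= m)%N ->
  opnorm (sqrt_iter Z m - sqrt_iter Z n) <= 2 / n.+1%:R.
Proof.
move=> Z1 nm.
have : opnorm (sqrt_iter Z m - sqrt_iter Z n) <= sqrt_rate R n - sqrt_rate R m.
  rewrite -(subnKC nm); elim: (m - n)%N => [|k IHk].
    by rewrite addn0 !subrr opnorm0.
  rewrite addnS.
  apply: (le_trans (opnormDB (sqrt_iter Z (n + k)) _ _)).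
  rewrite -[leRHS](subrKA (sqrt_rate R (n + k))) addrC.
  by apply: lerD; [exact: IHk|exact: sqrt_iter_step].
have /andP[_ en] := sqrt_rate_bounds R n; have /andP[em _] := sqrt_rate_bounds R m.
move=> /le_trans; apply; apply: (@le_trans _ _ (2 / n.+2%:R)).
  by rewrite (le_trans _ en)// lerBlDr lerDl.
by rewrite ler_wpM2l// lef_pV2 ?posrE// ler_nat.
Qed.

Lemma sqrt_iter_comm X Z n : X * Z = Z * X ->
  X * sqrt_iter Z n = sqrt_iter Z n * X.
Proof.
move=> XZ; elim: n => [|n IHn] /=; first by rewrite mulr0 mul0r.
rewrite bop_scalerAr bop_scalerAl mulrDr mulrDl XZ; congr (_ *: (_ + _)).
by rewrite mulrA IHn -mulrA IHn mulrA.
Qed.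

Lemma sqrt_iter_selfadjoint Z n : selfadjoint_op Z ->
  selfadjoint_op (sqrt_iter Z n).
Proof.
move=> sZ; elim: n => [|n IHn] x y; first by rewrite /= rdot0l rdotC rdot0l.
by rewrite [sqrt_iter _ _]/= !bopZ !bopD !bopM !rdotE sZ !IHn.
Qed.

(** [L] plays the role of [1 - sqrt (1 - Z)]: the equation says [(1 - L)^2 = 1 - Z]. The other
    clauses are inherited from the iterates. *)
Lemma one_minus_sqrt Z : opnorm Z <= 1 -> selfadjoint_op Z ->
  exists L, [/\ L + L = Z + L * L, opnorm L <= 1, selfadjoint_op L &
    forall X, X * Z = Z * X -> X * L = L * X].
Proof.
move=> Z1 sZ.
have [L LY] := bop_complete_rate (fun n m => @sqrt_iter_cauchy Z n m Z1).
exists L; have L1 : opnorm L <= 1.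
  rewrite -subr_le0; apply: (@archi_le0 _ _ 2) => n.
  have := opnormD_le (L - sqrt_iter Z n) (sqrt_iter Z n); rewrite subrK.
  have := LY n; have := sqrt_iter_norm n Z1.
  have /andP[+ _] := sqrt_rate_bounds R n; move: (n.+1%:R^-1) => i; lra.
split => //.
- apply/eqP; rewrite -subr_eq0; apply/eqP.
  apply: (@opnorm_archi_eq0 _ _ _ 8) => n.
  (* Twice the iterate of index [n + 1] is [Z] plus the square of the previous one. The constant 8
     collects 4 from the first term and 2 from each of the two products. *)
  have -> : L + L - (Z + L * L) = 2%:C *: (L - sqrt_iter Z n.+1) +
      (sqrt_iter Z n * (sqrt_iter Z n - L) + (sqrt_iter Z n - L) * L).
    rewrite -sqr_subr /= scalerBr scalerA -rmorphM divff//= scale1r.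
    rewrite rmorphMn rmorph1 scaler_nat mulr2n opprD !addrA.
    congr (_ - _); rewrite -!addrA; congr (_ + (_ + _)).
    by rewrite opprD -addrA addNr addr0.
  have -> : 8 / n.+1%:R = 2 * (2 / n.+1%:R) + (2 / n.+1%:R + 2 / n.+1%:R) :> R.
    by ring.
  apply: (le_trans (opnormD_le _ _)); apply: lerD.
    rewrite opnormZr//.
    have : 2 / n.+2%:R <= 2 / n.+1%:R :> R.
      by rewrite ler_wpM2l// lef_pV2 ?posrE// ler_nat.
    have := LY n.+1; move: (n.+2%:R^-1) (n.+1%:R^-1) => i j; lra.
  have Yn : opnorm (sqrt_iter Z n - L) <= 2 / n.+1%:R by rewrite opnormC; exact: LY.
  have Y1 : opnorm (sqrt_iter Z n) <= 1.
    have /andP[+ _] := sqrt_rate_bounds R n.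
    by have := sqrt_iter_norm n Z1; lra.
  rewrite (le_trans (opnormD_le _ _))//; apply: lerD.
    apply: (le_trans (opnormM _ _)).
    by rewrite -[leRHS]mul1r; apply: ler_pM; rewrite ?opnorm_ge0.
  apply: (le_trans (opnormM _ _)).
  by rewrite -[leRHS]mulr1; apply: ler_pM; rewrite ?opnorm_ge0.
- move=> x y; apply/eqP; rewrite -subr_eq0 -normr_le0.
  apply: (@archi_le0 _ _ (4 * (rnorm x * rnorm y))) => n.
  have -> : rdot (L x) y - rdot x (L y) =
      rdot ((L - sqrt_iter Z n) x) y - rdot x ((L - sqrt_iter Z n) y).
    by rewrite !(bopD, bopN) !rdotE (sqrt_iter_selfadjoint n sZ); ring.
  rewrite (le_trans (ler_normB _ _))//.
  have := rdot_CS ((L - sqrt_iter Z n) x) y.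
  have := rdot_CS x ((L - sqrt_iter Z n) y).
  have h z : rnorm ((L - sqrt_iter Z n) z) <= 2 / n.+1%:R * rnorm z.
    by rewrite (le_trans (le_opnorm _ _))// ler_wpM2r ?rnorm_ge0 ?LY.
  have := ler_wpM2l (rnorm_ge0 x) (h y); have := ler_wpM2r (rnorm_ge0 y) (h x).
  move: (n.+1%:R^-1) => i; lra.
- move=> X XZ; apply/eqP; rewrite -subr_eq0; apply/eqP.
  apply: (@opnorm_archi_eq0 _ _ _ (4 * opnorm X)) => n.
  have -> : X * L - L * X = X * (L - sqrt_iter Z n) - (L - sqrt_iter Z n) * X.
    by rewrite mulrBr mulrBl (sqrt_iter_comm n XZ) opprB addrA subrK.
  rewrite (le_trans (opnormB_le _ _))//.
  have := opnormM X (L - sqrt_iter Z n); have := opnormM (L - sqrt_iter Z n) X.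
  have := ler_wpM2l (opnorm_ge0 X) (LY n); have := ler_wpM2r (opnorm_ge0 X) (LY n).
  move: (n.+1%:R^-1) => i; lra.
Qed.

(** After scaling, [1 - L] is the root, positive because [L] has norm at most 1. The commutation
    clause is what [sqrt_intertwine] applies to [Yd * Y]. *)
Lemma sqrt_exists P : positive_op P -> exists S,
  [/\ positive_op S, S ^+ 2 = P & forall X, X * P = P * X -> X * S = S * X].
Proof.
move=> P0; have sP := positive_selfadjoint P0.
(* Adding 1 keeps [c] positive when [P = 0]; the forms of [P / c] and of [Z] then lie between 0 and
   [|x|^2]. *)
pose c := opnorm P + 1; have c0 : 0 < c by rewrite ltr_wpDl ?opnorm_ge0.
pose Z : bop H := 1 - (c^-1)%:C *: P.
have ZE x y : rdot (Z x) y = rdot x y - c^-1 * rdot (P x) y.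
  by rewrite /Z bopD bop1 bopN bopZ !rdotE.
have sZ : selfadjoint_op Z.
  by move=> x y; rewrite ZE [RHS]rdotC ZE sP [rdot y x]rdotC [rdot (P y) x]rdotC.
have cP x : 0 <= c^-1 * rdot (P x) x <= rnorm x ^+ 2.
  apply/andP; split.
    by apply: mulr_ge0; [rewrite invr_ge0 ltW|exact: positive_rdot_ge0].
  rewrite ler_pdivrMl//.
  rewrite (le_trans (rdot_le_opnorm _ _))// ler_wpM2r ?sqr_ge0//.
  by rewrite lerDl.
have Z1 : opnorm Z <= 1.
  apply: positive_opnorm_le => // [|x]; last first.
    by rewrite ZE rdotxx; have := cP x; lra.
  apply: selfadjoint_rdot_ge0_positive => // x.
  by rewrite ZE rdotxx; have := cP x; lra.
have [L [LE L1 sL cL]] := one_minus_sqrt Z1 sZ.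
exists ((Num.sqrt c)%:C *: (1 - L)); split.
- apply: positive_opZ; first exact: sqrtr_ge0.
  apply: selfadjoint_rdot_ge0_positive => [x y|x].
    by rewrite !(bopD, bopN, bop1) !rdotE sL.
  rewrite !(bopD, bopN, bop1) !rdotE rdotxx subr_ge0.
  by rewrite (le_trans (rdot_le_opnorm _ _))// ler_piMl ?sqr_ge0.
- rewrite expr2 bop_scalerAl bop_scalerAr scalerA -rmorphM -expr2.
  rewrite sqr_sqrtr ?ltW// mulrBl mul1r mulrBr mulr1.
  have -> : L * L = L + L - Z by rewrite LE addrC addKr.
  rewrite opprB [L + L - Z - L]addrAC addrK addrA subrK /Z subKr.
  by rewrite scalerA -rmorphM divff ?gt_eqF// scale1r.
- move=> X XP; have XL : X * L = L * X.
    apply: cL; rewrite /Z mulrBr mulrBl mulr1 mul1r.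
    by rewrite bop_scalerAr bop_scalerAl XP.
  by rewrite bop_scalerAr bop_scalerAl mulrBr mulrBl mulr1 mul1r XL.
Qed.
End SquareRoot.

(** * The absolute value and the mixed Schwarz inequality *)

Section AbsoluteValue.
Variables (R : realType) (H : hilbertType R).
Implicit Types (x y z : H) (A B P S X Y : bop H).

Lemma rdot_adjointl A x y : rdot (adjoint A x) y = rdot x (A y).
Proof. by rewrite rdotC -rdot_adjoint rdotC. Qed.

Lemma rnorm_eq0_rdot x : rdot x x <= 0 -> x = 0.
Proof.
rewrite rdotxx => x0; apply: rnorm_le0.
by rewrite -(@ler_pXn2r _ 2) ?nnegrE ?rnorm_ge0// expr0n.
Qed.

(* With Y = S1 X - X S2 one has S1 Y = - Y S2, so that Y*Y commutes with S2 and
   with a square root B of it; then <S1 Y x, Y x> = - |Y B x|^2, which forces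
   S1 Y = 0 = Y S2 and finally Y = 0. *)
Lemma sqrt_intertwine S1 S2 X : positive_op S1 -> positive_op S2 ->
  S1 ^+ 2 * X = X * S2 ^+ 2 -> S1 * X = X * S2.
Proof.
move=> P1 P2 eqX; have s1 := positive_selfadjoint P1.
have s2 := positive_selfadjoint P2.
pose Y := S1 * X - X * S2; pose Yd := adjoint Y.
have S1Y x : S1 (Y x) = - Y (S2 x).
  rewrite -[LHS]/((S1 * Y) x) -[RHS]/((- (Y * S2)) x); congr (bop_fun _ x).
  by rewrite /Y mulrBr mulrBl opprB !mulrA -expr2 eqX expr2 mulrA.
have YdY : (Yd * Y) * S2 = S2 * (Yd * Y).
  apply: bop_eq => x; apply: rdot_ext => z.
  rewrite !bopM s2 !rdot_adjointl -[Y (S2 x)]opprK -S1Y rdotNl s1 S1Y.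
  by rewrite rdotNr opprK.
have [B [PB B2 cB]] := sqrt_exists P2; have sB := positive_selfadjoint PB.
have S2E x : S2 x = B (B x) by rewrite -B2.
have YB x : Y (B x) = 0.
  apply: rnorm_eq0_rdot.
  have -> : rdot (Y (B x)) (Y (B x)) = - rdot (S1 (Y x)) (Y x).
    rewrite S1Y rdotNl opprK S2E -[RHS]rdot_adjointl.
    rewrite -[adjoint Y _]/((Yd * Y * B) (B x)) cB// bopM sB bopM.
    by rewrite rdot_adjointl.
  by rewrite oppr_le0 positive_rdot_ge0.
have YS2 x : Y (S2 x) = 0 by rewrite S2E YB.
have S1Y0 x : S1 (Y x) = 0 by rewrite S1Y YS2 oppr0.
have S2Yd z : S2 (Yd z) = 0.
  by apply: rdot_ext => x; rewrite s2 rdot_adjointl YS2 rdot0l rdotC rdot0l.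
(* [S2] vanishes on the range of [Yd], so there [Y] acts as [S1 * X]; moving [S1] to the other side
   meets [S1 (Y x) = 0]. *)
have YdY0 x : Yd (Y x) = 0.
  apply: rnorm_eq0_rdot; rewrite rdot_adjointl.
  have -> : Y (Yd (Y x)) = S1 (X (Yd (Y x))).
    by rewrite {1}/Y bopD bopN !bopM S2Yd linear0 subr0.
  by rewrite -s1 S1Y0 rdot0l.
apply/eqP; rewrite -subr_eq0; apply/eqP/bop_eq => x.
by apply: rnorm_eq0_rdot; rewrite -rdot_adjointl -/Y -/Yd YdY0 rdot0l.
Qed.

Lemma abs_opP A : positive_op (abs_op A) /\ abs_op A ^+ 2 = adjoint A * A.
Proof.
have [S [S0 S2 _]] := sqrt_exists (positive_adjointM A).
rewrite /abs_op /sqrt_op.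
by apply: (@xgetPex _ (0 : bop H)
  [set S : bop H | positive_op S /\ S ^+ 2 = adjoint A * A]); exists S.
Qed.

Lemma abs_op_ge0 A : positive_op (abs_op A).
Proof. by have [] := abs_opP A. Qed.

Lemma sqr_abs_op A : abs_op A ^+ 2 = adjoint A * A.
Proof. by have [] := abs_opP A. Qed.

Lemma rnorm_abs_op A x : rnorm (abs_op A x) = rnorm (A x).
Proof.
apply/eqP; rewrite -(@eqrXn2 _ 2) ?rnorm_ge0//; apply/eqP.
rewrite -[RHS]rdot_adjointM -sqr_abs_op selfadjoint_sqr//.
exact: positive_selfadjoint (abs_op_ge0 A).
Qed.

(** The relation holds for the squares, both sides being [A * adjoint A * A], and descends to the
    positive roots. *)
Lemma abs_op_intertwine A : abs_op (adjoint A) * A = A * abs_op A.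
Proof.
apply: sqrt_intertwine; try exact: abs_op_ge0.
by rewrite !sqr_abs_op adjointK mulrA.
Qed.

(* Writing x = (|A| + e) u, the intertwining relation gives
   A x = (|A*| + e) A u, to which Cauchy-Schwarz for |A*| + e applies. *)
Lemma mixed_schwarz A x y : cabs (hdot (A x) y) ^+ 2 <=
  rdot (abs_op A x) x * rdot (abs_op (adjoint A) y) y.
Proof.
rewrite -subr_le0; set S1 := abs_op A; set S2 := abs_op (adjoint A).
have P1 : positive_op S1 := abs_op_ge0 _.
have P2 : positive_op S2 := abs_op_ge0 _.
have s1 := positive_selfadjoint P1.
apply: (@archi_le0 _ _ (rdot (S1 x) x * rnorm y ^+ 2)) => n.
set e : R := n.+1%:R^-1; have e0 : 0 < e by rewrite invr_gt0.
have [u uE] := positive_shift_surj x P1 e0.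
pose T : bop H := S2 + e%:C *: (1 : bop H).
have PT : positive_op T.
  apply: positive_opD => //; apply: positive_opZ; first exact: ltW.
  exact: positive_op1.
have AxE : A x = T (A u).
  rewrite -uE bop_appD bop_appZ /T bopD bopZ bop1.
  by rewrite -[A (S1 u)]/((A * S1) u) -abs_op_intertwine.
(* The left side is [<S1 x, S1 u> = <S1 x, x> - e <S1 x, u>], and
   [<S1 x, u> = |S1 u|^2 + e <S1 u, u>] is nonnegative. *)
have le1 : rdot (T (A u)) (A u) <= rdot (S1 x) x.
  rewrite -AxE rdot_adjoint -[adjoint A (A u)]/((adjoint A * A) u) -sqr_abs_op.
  rewrite -/S1 expr2 bopM -s1.
  have -> : S1 u = x - e%:C *: u by rewrite -uE addrK.
  rewrite rdotDr rdotNr rdotZr gerBl mulr_ge0 ?(ltW e0)//.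
  rewrite s1 -uE rdotDl rdotZl rdotxx addr_ge0 ?sqr_ge0//.
  by rewrite mulr_ge0 ?(ltW e0)// rdotC positive_rdot_ge0.
have := cabs_positive_CS (A u) y PT; rewrite -AxE => /le_trans h.
rewrite lerBlDr; apply: h.
rewrite AxE; apply: (le_trans (ler_wpM2r _ le1)); first exact: positive_rdot_ge0.
rewrite /T bopD bopZ bop1 rdotDl rdotZl rdotxx mulrDr -mulrA [e * _]mulrC.
by rewrite addrC.
Qed.

End AbsoluteValue.

(** * Riemann integrals of vector-valued functions *)

Section RiemannSums.
Variables (R : realType) (V : normedModType R[i]).
Implicit Types (a b : R) (s : seq R) (F : R -> V).

Lemma itv_partition_telescope (W : zmodType) (f : R -> W) a b s :
  itv_partition a b s ->
  \sum_(i < size s) (f (nth b s i) - f (nth b (a :: s) i)) = f b - f a.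
Proof.
move=> [_ /eqP lb].
rewrite -(big_mkord xpredT (fun i => f (nth b s i) - f (nth b (a :: s) i))).
rewrite (@telescope_sumr _ 0 (size s) (fun i => f (nth b (a :: s) i)))//=.
by rewrite -[nth b (a :: s) (size s)](last_nth b) lb.
Qed.

(** The increments of [G] telescope, and an error quadratic in the length of each interval sums to
    at most [|K| (b - a)] times the mesh. The estimate for an arbitrary tag [c] stands in for a mean
    value theorem. *)
Lemma is_riemann_integral_primitive F (G : R -> V) (K : R) a b : a <= b ->
  (forall u c v, a <= u -> u <= c -> c <= v -> v <= b ->
    rnorm ((v - u)%:C *: F c - (G v - G u)) <= K * (v - u) ^+ 2) ->
  is_riemann_integral F a b (G b - G a).
Proof.
move=> ab GK e e0.
(* The 1 keeps the denominator positive and makes the final bound strict. *)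
exists (e / (`|K| * (b - a) + 1)) => [|s c sab mesh tag].
  by rewrite divr_gt0// ltr_wpDl// mulr_ge0// subr_ge0.
set d := e / _ in mesh.
have pos : 0 < `|K| * (b - a) + 1.
  by rewrite ltr_wpDl// mulr_ge0// subr_ge0.
rewrite -(itv_partition_telescope G sab) /riemann_sum -sumrB.
apply: (@le_lt_trans _ _
    (\sum_(i < size s) `|K| * d * (nth b s i - nth b (a :: s) i))); last first.
  rewrite -mulr_sumr (itv_partition_telescope id sab) mulrAC.
  rewrite /d mulrA ltr_pdivrMr// mulrC ltr_pM2l//.
  by rewrite ltrDl.
apply: (@le_trans _ _ (\sum_(i < size s)
    rnorm ((nth b s i - nth b (a :: s) i)%:C *: F (c i) - (G (nth b s i) - G (nth b (a :: s) i))))).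
  elim/big_ind2: _ => [|x r y r' xr yr|//]; first by rewrite rnorm0.
  by rewrite (le_trans (rnormD _ _))// lerD.
apply: ler_sum => i _; have /andP[uc cv] := tag i (ltn_ord i).
have au : a <= nth b (a :: s) i.
  by apply: itv_partition_nth_ge sab; exact: ltnW (ltn_ord i).
have vb : nth b s i <= b.
  by apply: (@itv_partition_nth_le _ _ a b s i.+1) sab; exact: ltn_ord.
apply: (le_trans (GK _ _ _ au uc cv vb)).
have uv : 0 <= nth b s i - nth b (a :: s) i by rewrite subr_ge0 (le_trans uc).
rewrite expr2 mulrA ler_wpM2r//.
apply: (@le_trans _ _ (`|K| * (nth b s i - nth b (a :: s) i))).
  by rewrite ler_wpM2r// ler_norm.
by rewrite ler_wpM2l// ltW// mesh.
Qed.

(** Equal subdivision. Without such partitions the condition on Riemann sums would be vacuous and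
    could not determine the integral. *)
Lemma fine_partition a b (d : R) : a < b -> 0 < d -> exists s,
  [/\ itv_partition a b s,
    forall i, (i < size s)%N -> nth b s i - nth b (a :: s) i < d &
    forall i, (i < size s)%N -> nth b (a :: s) i <= nth b s i].
Proof.
move=> ab d0.
have ba : 0 < b - a by rewrite subr_gt0.
have [n nd] : exists n, (b - a) / n.+1%:R < d.
  exists (Num.truncn ((b - a) / d)).
  by rewrite ltr_pdivrMr// mulrC -ltr_pdivrMr// truncnS_gt.
pose g i : R := a + (b - a) * i%:R / n.+1%:R.
have step i : g i.+1 - g i = (b - a) / n.+1%:R.
  by rewrite /g -[i.+1%:R]natr1; ring.
have [s [sz sE]] : exists s,
    size s = n.+1 /\ forall i, (i < size s)%N -> nth b s i = g i.+1.
  exists (mkseq (fun i => g i.+1) n.+1); rewrite size_mkseq; split => // i im.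
  by rewrite nth_mkseq.
have tE i : (i <= size s)%N -> nth b (a :: s) i = g i.
  case: i => [_|i im]; first by rewrite /g /= mulr0 mul0r addr0.
  exact: sE.
have lt i : (i < size s)%N -> nth b (a :: s) i < nth b s i.
  by move=> im; rewrite (tE _ (ltnW im)) sE// -subr_gt0 step divr_gt0.
exists s; split => [|i im|i im]; last exact/ltW/lt.
- split; first exact/(pathP b).
  rewrite (last_nth b) tE// sz /g mulfK ?pnatr_eq0//.
  by rewrite addrC subrK.
- by rewrite sE// (tE _ (ltnW im)) step.
Qed.

Lemma is_riemann_integral_unique F a b (v w : V) : a < b ->
  is_riemann_integral F a b v -> is_riemann_integral F a b w -> v = w.
Proof.
move=> ab Fv Fw; apply/eqP; rewrite -subr_eq0; apply/eqP/rnorm_le0.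
rewrite leNgt; apply/negP => vw; have e0 : 0 < rnorm (v - w) / 2 by rewrite divr_gt0.
have [d d0 dv] := Fv _ e0; have [d' d'0 dw] := Fw _ e0.
have [s [sab mesh tag]] : exists s, [/\ itv_partition a b s,
    forall i, (i < size s)%N -> nth b s i - nth b (a :: s) i < Num.min d d' &
    forall i, (i < size s)%N -> nth b (a :: s) i <= nth b s i].
  by apply: fine_partition => //; rewrite lt_min d0.
have {}dv := dv s (nth b (a :: s)) sab; have {}dw := dw s (nth b (a :: s)) sab.
have := rnormDB (riemann_sum F a b s (nth b (a :: s))) v w.
rewrite [rnorm (v - riemann_sum _ _ _ _ _)]rnormC leNgt => /negP; apply.
rewrite [ltRHS]splitr ltrD//.
  apply: dv => i im; rewrite ?lexx ?tag//.
  by have := mesh i im; rewrite lt_min => /andP[].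
apply: dw => i im; rewrite ?lexx ?tag//.
by have := mesh i im; rewrite lt_min => /andP[].
Qed.

Lemma riemann_integralE F a b (v : V) : a < b ->
  is_riemann_integral F a b v -> riemann_integral F a b = v.
Proof.
move=> ab Fv; apply: xget_unique => // w Fw.
exact: is_riemann_integral_unique Fw Fv.
Qed.

Lemma riemann_integral_quadratic (A0 A1 A2 : V) :
  riemann_integral (fun t : R => A0 + t%:C *: A1 + (t ^+ 2)%:C *: A2) 0 1 =
  A0 + (2^-1)%:C *: A1 + (3^-1)%:C *: A2.
Proof.
apply: riemann_integralE => //.
pose G (t : R) := t%:C *: A0 + (t ^+ 2 / 2)%:C *: A1 + (t ^+ 3 / 3)%:C *: A2.
have -> : A0 + (2^-1)%:C *: A1 + (3^-1)%:C *: A2 = G 1 - G 0.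
  rewrite /G !expr1n !expr0n /= !mul0r !mul1r !scale0r !addr0 subr0.
  by rewrite scale1r.
(* The constant term has no error. In [0, 1], [c] differs from [(u + v) / 2] by at most [v - u], and
   [c^2] from [(u^2 + u v + v^2) / 3] by at most [v^2 - u^2 <= 2 (v - u)]. *)
apply: (@is_riemann_integral_primitive _ _ (rnorm A1 + 2 * rnorm A2)) => //.
move=> u c v u0 uc cv v1.
have -> : (v - u)%:C *: (A0 + c%:C *: A1 + (c ^+ 2)%:C *: A2) - (G v - G u) =
    ((v - u) * c - (v ^+ 2 - u ^+ 2) / 2)%:C *: A1 +
    ((v - u) * c ^+ 2 - (v ^+ 3 - u ^+ 3) / 3)%:C *: A2.
  have GE : G v - G u = (v - u)%:C *: A0 + ((v ^+ 2 - u ^+ 2) / 2)%:C *: A1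
      + ((v ^+ 3 - u ^+ 3) / 3)%:C *: A2.
    rewrite /G !mulrBl !rmorphB !scalerBl.
    by rewrite opprD [- (_ + _)]opprD addrACA [X in X + _]addrACA.
  rewrite GE !scalerDr !scalerA -!rmorphM opprD opprD addrACA.
  by rewrite [X in X + _]addrACA subrr add0r !rmorphB !scalerBl.
apply: (le_trans (rnormD _ _)); rewrite [leRHS]mulrDl !rnormZr.
have uv : 0 <= v - u by lra.
rewrite [rnorm A1 * _]mulrC [2 * _ * _]mulrAC; apply: lerD.
  rewrite ler_wpM2r ?rnorm_ge0//.
  have -> : (v - u) * c - (v ^+ 2 - u ^+ 2) / 2 = (v - u) * (c - (u + v) / 2).
    by ring.
  rewrite normrM (ger0_norm uv) expr2 ler_wpM2l// ler_norml.
  by apply/andP; split; lra.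
rewrite ler_wpM2r ?rnorm_ge0//.
have -> : (v - u) * c ^+ 2 - (v ^+ 3 - u ^+ 3) / 3 =
    (v - u) * (c ^+ 2 - (u ^+ 2 + u * v + v ^+ 2) / 3) by ring.
rewrite normrM (ger0_norm uv) expr2 mulrCA ler_wpM2l// ler_norml.
by apply/andP; split; nra.
Qed.

End RiemannSums.

(** * The numerical radius, the operator S and the integral *)

Section NumericalRadius.
Variables (R : realType) (H : hilbertType R).
Implicit Types (x y z : H) (A P S : bop H).

Lemma cabs_hdot_CS x y : cabs (hdot x y) <= rnorm x * rnorm y.
Proof.
rewrite -(@ler_pXn2r _ 2) ?nnegrE ?mulr_ge0 ?rnorm_ge0 ?cabs_ge0//.
rewrite exprMn -!rdotxx; exact: (cabs_positive_CS x y (@positive_op1 _ _)).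
Qed.

Lemma le_numerical_radius A x : rnorm x = 1 ->
  cabs (hdot (A x) x) <= numerical_radius A.
Proof.
move=> x1; apply: ub_le_sup; last by exists x.
exists (opnorm A) => _ [y /= y1 <-].
apply: (le_trans (cabs_hdot_CS _ _)); apply: (le_trans (ler_wpM2r _ (le_opnorm _ _))).
  exact: rnorm_ge0.
by rewrite y1 !mulr1.
Qed.

(** The sign of [r] matters when [H] is zero: there is no unit vector, and the supremum of the empty
    set is 0. *)
Lemma numerical_radius_le A (r : R) : 0 <= r ->
  (forall x, rnorm x = 1 -> cabs (hdot (A x) x) <= r) -> numerical_radius A <= r.
Proof.
move=> r0 Ar; rewrite /numerical_radius; set E := (X in sup X).
have [->|/set0P E0] := eqVneq E set0; first by rewrite sup0.
by apply: ge_sup => // _ [x /= x1 <-]; exact: Ar.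
Qed.

Lemma numerical_radius_ge0 A : 0 <= numerical_radius A.
Proof.
rewrite /numerical_radius; set E := (X in sup X).
have [->|/set0P [_ [x /= x1 _]]] := eqVneq E set0; first by rewrite sup0.
exact: le_trans (cabs_ge0 _) (le_numerical_radius A x1).
Qed.

Lemma positive_op_sqr P : selfadjoint_op P -> positive_op (P ^+ 2).
Proof.
move=> sP; apply: selfadjoint_rdot_ge0_positive => [x y|x].
  by rewrite expr2 !bopM !sP.
by rewrite selfadjoint_sqr// sqr_ge0.
Qed.

Lemma sqr_rdot_le P x : selfadjoint_op P -> rnorm x = 1 ->
  rdot (P x) x ^+ 2 <= rdot ((P ^+ 2) x) x.
Proof.
move=> sP x1; rewrite selfadjoint_sqr// -real_normK ?num_real//.
have := rdot_CS (P x) x; rewrite x1 mulr1 => h.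
by rewrite ler_pXn2r ?nnegrE ?rnorm_ge0.
Qed.

Section ConvexCombination.
Variables (A : bop H) (alpha : R).

Let S1 := abs_op A.
Let S2 := abs_op (adjoint A).
Let M : bop H := (2^-1)%:C *: (S1 + S2).
Let S : bop H := alpha%:C *: M ^+ 2 + (1 - alpha)%:C *: S1 ^+ 2.

Lemma selfadjoint_mean_abs : selfadjoint_op M.
Proof.
apply: positive_selfadjoint; apply: positive_opZ; first by rewrite invr_ge0.
by apply: positive_opD; exact: abs_op_ge0.
Qed.

Lemma positive_convex_abs : 0 <= alpha <= 1 -> positive_op S.
Proof.
move=> /andP[a0 a1]; apply: positive_opD; apply: positive_opZ => //.
- exact/positive_op_sqr/selfadjoint_mean_abs.
- by rewrite subr_ge0.
- exact/positive_op_sqr/positive_selfadjoint/abs_op_ge0.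
Qed.

Lemma sqr_cabs_le_convex_abs x : 0 <= alpha <= 1 -> rnorm x = 1 ->
  cabs (hdot (A x) x) ^+ 2 <= rdot (S x) x.
Proof.
move=> /andP[a0 a1] x1.
have sS1 : selfadjoint_op S1 := positive_selfadjoint (abs_op_ge0 A).
have p1 : 0 <= rdot (S1 x) x := positive_rdot_ge0 x (abs_op_ge0 _).
have p2 : 0 <= rdot (S2 x) x := positive_rdot_ge0 x (abs_op_ge0 _).
have -> : rdot (S x) x =
    alpha * rdot ((M ^+ 2) x) x + (1 - alpha) * rdot ((S1 ^+ 2) x) x.
  by rewrite -!rdotZl -rdotDl.
have q1 : cabs (hdot (A x) x) ^+ 2 <= rdot ((S1 ^+ 2) x) x.
  rewrite selfadjoint_sqr// rnorm_abs_op ler_pXn2r ?nnegrE ?rnorm_ge0 ?cabs_ge0//.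
  by have := cabs_hdot_CS (A x) x; rewrite x1 mulr1.
(* Mixed Schwarz, then the arithmetic-geometric mean inequality, bound the left side by
   [<M x, x>^2], hence by [<M^2 x, x>]. *)
have q2 : cabs (hdot (A x) x) ^+ 2 <= rdot ((M ^+ 2) x) x.
  apply: le_trans (sqr_rdot_le selfadjoint_mean_abs x1).
  rewrite /M bopZ bopD rdotZl rdotDl.
  apply: (le_trans (mixed_schwarz A x x)); rewrite -/S1 -/S2.
  have := sqr_ge0 (rdot (S1 x) x - rdot (S2 x) x); lra.
have a1' : 0 <= 1 - alpha by rewrite subr_ge0.
apply: le_trans (lerD (ler_wpM2l a0 q2) (ler_wpM2l a1' q1)).
by rewrite -mulrDl addrC subrK mul1r.
Qed.

End ConvexCombination.

(** The weights [(1 - t)^2], [2 t (1 - t)] and [t^2] each integrate to 1/3. The parameter [w] will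
    be the squared numerical radius. *)
Lemma riemann_integral_sqr_affine S (w : R) :
  riemann_integral (fun t : R =>
    ((1 - t)%:C *: S + (t * w)%:C *: (1 : bop H)) ^+ 2) 0 1 =
  (3^-1)%:C *: (S ^+ 2 + w%:C *: S + (w ^+ 2)%:C *: (1 : bop H)).
Proof.
pose A1 : bop H := (2 * w)%:C *: S - 2%:C *: S ^+ 2.
pose A2 : bop H := S ^+ 2 - (2 * w)%:C *: S + (w ^+ 2)%:C *: (1 : bop H).
have -> : (fun t : R => ((1 - t)%:C *: S + (t * w)%:C *: (1 : bop H)) ^+ 2) =
    (fun t : R => S ^+ 2 + t%:C *: A1 + (t ^+ 2)%:C *: A2).
  apply/funext => t; apply: bop_eq => x; apply: rdot_ext => z.
  rewrite /A1 /A2 !expr2 !(bopD, bopM, bopZ, bopN, bop1, bop_appD, bop_appZ).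
  by rewrite !rdotE; ring.
rewrite riemann_integral_quadratic; apply: bop_eq => x; apply: rdot_ext => z.
rewrite /A1 /A2 !expr2 !(bopD, bopM, bopZ, bopN, bop1, bop_appD, bop_appZ).
by rewrite !rdotE; field.
Qed.

End NumericalRadius.

Theorem corollary3p8 (R : realType) (H : hilbertType R) (A : bop H)
    (alpha : R) (halpha : 0 <= alpha <= 1) :
  let w := numerical_radius A in
  let S : bop H :=
    alpha%:C *: (2^-1 *: (abs_op A + abs_op (adjoint A))) ^+ 2
    + (1 - alpha)%:C *: abs_op A ^+ 2 in
  w ^+ 2
    <= Num.sqrt (opnorm (riemann_integral
         (fun t : R => ((1 - t)%:C *: S + (t * w ^+ 2)%:C *: (1 : bop H)) ^+ 2) 0 1))
    <= opnorm S.
Proof.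
have half : 2^-1 = (2^-1)%:C :> R[i] by rewrite fmorphV rmorphMn rmorph1.
rewrite /= half; set S : bop H := alpha%:C *: _ + _; set w := numerical_radius A.
have PS : positive_op S := positive_convex_abs A halpha.
have sS := positive_selfadjoint PS.
have w0 : 0 <= w := numerical_radius_ge0 A.
have qS x : rnorm x = 1 -> cabs (hdot (A x) x) ^+ 2 <= rdot (S x) x.
  exact: sqr_cabs_le_convex_abs.
clearbody S.
have wS : w ^+ 2 <= opnorm S.
  rewrite -[leRHS]sqr_sqrtr ?opnorm_ge0// ler_pXn2r ?nnegrE ?sqrtr_ge0//.
  apply: numerical_radius_le => [|x x1]; first exact: sqrtr_ge0.
  rewrite -(@ler_pXn2r _ 2) ?nnegrE ?sqrtr_ge0 ?cabs_ge0// sqr_sqrtr ?opnorm_ge0//.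
  apply: (le_trans (qS x x1)); have := rdot_le_opnorm S x.
  by rewrite x1 expr1n mulr1.
rewrite riemann_integral_sqr_affine; set J := (_ *: _ : bop H).
apply/andP; split; last first.
  rewrite -[leRHS]ger0_norm ?opnorm_ge0// -sqrtr_sqr ler_sqrt ?sqr_ge0//.
  rewrite /J opnormZr ?invr_ge0//.
  have := opnormD_le (S ^+ 2 + (w ^+ 2)%:C *: S) ((w ^+ 2 ^+ 2)%:C *: (1 : bop H)).
  have := opnormD_le (S ^+ 2) ((w ^+ 2)%:C *: S); rewrite !opnormZr ?sqr_ge0//.
  have := opnormM S S; rewrite -expr2.
  have := ler_wpM2l (sqr_ge0 (w ^+ 2)) (@opnorm1_le R H).
  have := sqr_ge0 w; have := opnorm_ge0 S; nra.
(* The supremum defining [w] runs over q and not over its powers, so the bound on [q^4] is used in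
   the form of a fourth root. *)
have wsqrt : w <= Num.sqrt (Num.sqrt (opnorm J)).
  apply: numerical_radius_le => [|x x1]; first exact: sqrtr_ge0.
  have q0 := cabs_ge0 (hdot (A x) x); have qw := le_numerical_radius A x1.
  have := qS _ x1; have := sqr_rdot_le sS x1; have := rdot_le_opnorm J x.
  rewrite x1 expr1n mulr1 /J bopZ !bopD !bopZ bop1 !rdotE rdotxx x1 expr1n mulr1.
  rewrite -/w in qw; move: q0 qw.
  move: (cabs _) (opnorm _) (rdot (S x) x) (rdot ((S ^+ 2) x) x) => q N r r2.
  move=> q0 qw JN r2r qr.
  have q2w : q ^+ 2 <= w ^+ 2 by rewrite ler_pXn2r ?nnegrE.
  (* Both [r] and [w^2] are at least [q^2], so each of the three terms of [<J x, x>] is at least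
     [q^4 / 3]. *)
  have q4 : (q ^+ 2) ^+ 2 <= N.
    have : (q ^+ 2) ^+ 2 <= r ^+ 2.
      by rewrite ler_pXn2r ?nnegrE ?sqr_ge0// (le_trans (sqr_ge0 q) qr).
    have := sqr_ge0 q; nra.
  have N0 : 0 <= N := le_trans (sqr_ge0 _) q4.
  rewrite -[leLHS]ger0_norm// -sqrtr_sqr ler_sqrt ?sqrtr_ge0//.
  by rewrite -[leLHS]ger0_norm ?sqr_ge0// -sqrtr_sqr ler_sqrt.
rewrite -[leRHS]sqr_sqrtr ?sqrtr_ge0// ler_pXn2r ?nnegrE ?sqrtr_ge0//.
Qed.
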